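(* Let $H$ be a hypergraph containing some $2$-edges and let $H'$ be its $2$-subdivision. If $H$ is degenerate, then so is $H'$.
   Context: A hypergraph $H=(V,E)$ has finite vertex set $V$ and edge set $E\subseteq 2^V$; $R(H)=\{|F|:F\in E\}$. $H_1\subseteq H_2$ means there is an injective $f\colon V(H_1)\to V(H_2)$ with $f(F)\in E(H_2)$ for all $F\in E(H_1)$. For $G$ on $n$ vertices, $h_n(G)=\sum_{F\in E(G)}1/\binom{n}{|F|}$; $\pi_n(H)=\max\{h_n(G): G\text{ on } n \text{ vertices}, R(G)\subseteq R(H), H\not\subseteq G\}$ and $\pi(H)=\lim_n\pi_n(H)$. $H$ is degenerate if $\pi(H)=|R(H)|-1$. The $2$-subdivision of $H$: if $H$ has $2$-edges $\{u_1,v_1\},\dots,\{u_t,v_t\}$, add $t$ new vertices $x_1,\dots,x_t$ and replace each $\{u_i,v_i\}$ by the two edges $\{u_i,x_i\},\{x_i,v_i\}$, keeping all other edges. *)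

(* Defs.v *)
From HB Require Import structures.
From mathcomp Require Import all_boot all_order all_algebra.
From mathcomp Require Import all_classical all_reals topology normedtype sequences.
From mathcomp Require Import Rstruct Rstruct_topology.
Set Implicit Arguments. Unset Strict Implicit. Unset Printing Implicit Defensive.
Import Order.TTheory GRing.Theory Num.Theory.
Local Open Scope ring_scope.

(* A hypergraph is a finite vertex type V together with an edge set
   E : {set {set V}}. *)

Definition edge_sizes (V : finType) (E : {set {set V}}) : seq nat :=
  undup [seq #|(F : {set V})| | F in E].

Definition hcontains (V1 : finType) (E1 : {set {set V1}})
    (V2 : finType) (E2 : {set {set V2}}) : bool :=
  [exists f : {ffun V1 -> V2},
     injectiveb f && [forall F in E1, (f @: F) \in E2]].

Definition hdens (n : nat) (G : {set {set 'I_n}}) : Rdefinitions.R :=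
  \sum_(F in G) ('C(n, #|F|)%:R)^-1.

Definition admissible (V : finType) (E : {set {set V}}) (n : nat)
    (G : {set {set 'I_n}}) : bool :=
  all (fun k => k \in edge_sizes E) (edge_sizes G) && ~~ hcontains E G.

(* π_n(H) = max of h_n(G) over admissible G (all h_n are >= 0, so starting
   the max at 0 is harmless; the admissible family is nonempty whenever H
   has an edge, witnessed by the empty hypergraph). *)
Definition pi_n (V : finType) (E : {set {set V}}) (n : nat) : Rdefinitions.R :=
  \big[Num.max/0]_(G : {set {set 'I_n}} | admissible E G) hdens G.

Definition degenerate (V : finType) (E : {set {set V}}) : Prop :=
  ((fun n => pi_n E n) @ \oo --> ((size (edge_sizes E))%:R - 1 : Rdefinitions.R))%classic.

Definition two_edges (V : finType) (E : {set {set V}}) :=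
  {F : {set V} | (F \in E) && (#|F| == 2)}.

Definition subdiv_vertex (V : finType) (E : {set {set V}}) : finType :=
  (V + two_edges E)%type.

Definition subdiv (V : finType) (E : {set {set V}}) : {set {set subdiv_vertex E}} :=
  [set (@inl V (two_edges E)) @: F | F : {set V} in E & #|F| != 2]
  :|: \bigcup_(e : two_edges E) [set [set inl x; inr e] | x in val e].

(* Main.v *)
(** Let [G] be a hypergraph on [n] vertices without the subdivision of [H], and
    [M] the number of vertices of that subdivision.  Replace the 2-edges of [G]
    by the pairs having at least [M] common neighbours.  A copy of [H] in the
    resulting [G'] would yield a subdivided copy in [G], choosing the subdividing
    vertices greedily, so [G'] is [H]-free.  Moreover [G'] has at most [o(n^2)]
    fewer 2-edges than [G]: the degree of [v] in [G'] is, up to a small error, at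
    least the average of [d(w)] over the neighbours [w] of [v], and these
    averages add up to at least the sum of the degrees because
    [d(w)/d(v) + d(v)/d(w) >= 2].  Hence the Turan density of the subdivision is
    at most that of [H]; conversely, all edges with sizes in [R(H)] other than
    [2] give the lower bound [|R(H)| - 1]. *)
Require Import Defs.
From mathcomp Require Import all_boot all_order all_algebra.
From mathcomp Require Import all_classical all_reals topology normedtype sequences realfun.
From mathcomp Require Import Rstruct Rstruct_topology.
From mathcomp Require Import ring lra.
(* Reimported because the classical_sets lemmas shadow those of finset. *)
From mathcomp Require Import finset.
Set Implicit Arguments. Unset Strict Implicit. Unset Printing Implicit Defensive.
Import Order.TTheory GRing.Theory Num.Theory.
Import numFieldNormedType.Exports.
Local Open Scope ring_scope.

(** * Degree sums and common neighbourhoods *)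

Definition nbhd (T : finType) (a : rel T) (v : T) : {set T} := [set w | a v w].

Definition conbhd (T : finType) (a : rel T) (M : nat) (v : T) : {set T} :=
  [set u | (u != v) && (M <= #|nbhd a v :&: nbhd a u|)%N].

(** Walks [v - w - u] are counted by their end [u]: [u = v] (the [.+1]) and each [u] in
    [conbhd a M v] account for at most [#|nbhd a v|] of them, every other [u] for at most [M]. *)
Lemma sum_nbhd_degree_le (T : finType) (a : rel T) (M : nat) (v : T) :
  symmetric a ->
  (\sum_(w in nbhd a v) #|nbhd a w| <=
     #|nbhd a v| * #|conbhd a M v|.+1 + M * #|T|)%N.
Proof.
move=> a_sym.
have -> : (\sum_(w in nbhd a v) #|nbhd a w| =
           \sum_u #|nbhd a v :&: nbhd a u|)%N.
  transitivity (\sum_(w in nbhd a v) \sum_u (u \in nbhd a w : nat))%N.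
    by apply: eq_bigr => w _; rewrite -sum1_card big_mkcond.
  rewrite exchange_big /=; apply: eq_bigr => u _.
  rewrite -sum1_card [RHS]big_mkcond [LHS]big_mkcond; apply: eq_bigr => w _.
  by rewrite !inE [a u w]a_sym; case: (a v w); case: (a w u).
apply: (@leq_trans (\sum_u ((u \in v |: conbhd a M v) * #|nbhd a v| + M))).
  apply: leq_sum => u _; rewrite !inE; case: eqVneq => [->|_] /=.
    by rewrite setIid mul1n leq_addr.
  case: (leqP M) => [_|/ltnW cM]; rewrite ?mul1n ?mul0n ?add0n //.
  by rewrite (leq_trans _ (leq_addr _ _)) // subset_leq_card // subsetIl.
rewrite big_split /= sum_nat_const (mulnC M) leq_add2r -big_distrl /=.
rewrite mulnC leq_mul2l.
apply/orP; right; rewrite -big_mkcond sum1_card cardsU1.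
by case: (v \notin _).
Qed.

(* With [x v := #|nbhd a v| + D], both sides are compared with the sum of
   [x w / x v] over ordered adjacent pairs: it is at least the degree sum since
   [t + 1/t >= 2], and the shift by [D] keeps the error term [M * #|T| / x v]
   small at vertices of low degree. *)
Lemma sum_degree_le_conbhd (R : realFieldType) (T : finType) (a : rel T)
    (M : nat) (D : R) :
  symmetric a -> 0 < D ->
  \sum_v #|nbhd a v|%:R <=
  \sum_v #|conbhd a M v|%:R + #|T|%:R * (1 + D + M%:R * #|T|%:R / D).
Proof.
move=> a_sym D_gt0; pose x v := #|nbhd a v|%:R + D.
have x_gt0 v : 0 < x v by rewrite ltr_wpDl.
apply: (@le_trans _ _ (\sum_v \sum_(w | a v w) x w / x v)).
  (* Reversing the pairs lets each ordered pair contribute [s / t + t / s] to twice the sum. *)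
  have sumS : \sum_v \sum_(w | a v w) x w / x v =
              \sum_v \sum_(w | a v w) x v / x w.
    rewrite (exchange_big_dep predT) //=; apply: eq_bigr => v _.
    by apply: eq_bigl => w; rewrite a_sym.
  suff: \sum_v #|nbhd a v|%:R *+ 2 <=
        \sum_v (\sum_(w | a v w) x w / x v + \sum_(w | a v w) x v / x w).
    rewrite [X in _ <= X]big_split /= -sumS sumrMnl -mulr2n; lra.
  apply: ler_sum => v _; rewrite -big_split /= -sum1_card natr_sum -sumrMnl.
  rewrite [X in X <= _](eq_bigl (a v)); last by move=> w; rewrite inE.
  apply: ler_sum => w _; have := x_gt0 v; have := x_gt0 w.
  move: (x w) (x v) => s t s0 t0.
  have -> : s / t + t / s = (s ^+ 2 + t ^+ 2) / (t * s).
    by field; rewrite !gt_eqF.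
  by rewrite ler_pdivlMr ?mulr_gt0 //; have := sqr_ge0 (s - t); nra.
rewrite mulr_natl -sumr_const -big_split /=; apply: ler_sum => v _.
rewrite -mulr_suml ler_pdivrMr //.
have := sum_nbhd_degree_le M v a_sym; rewrite -(ler_nat R) natr_sum.
rewrite natrD !natrM -natr1.
have -> : \sum_(w | a v w) x w = \sum_(w in nbhd a v) x w.
  by apply: eq_bigl => w; rewrite inE.
rewrite /x big_split /= sumr_const -mulr_natl.
set S := \sum_(w in _) _; set d := #|nbhd a v|%:R; set b := #|conbhd a M v|%:R.
move=> S_le.
have d0 : 0 <= d by []. have b0 : 0 <= b by [].
(* The error [M * #|T|] equals [q * D], one of the products in the expansion of
   [(b + 1 + D + q) * (d + D)]. *)
set q := _ / D; have qD : q * D = M%:R * #|T|%:R by rewrite divfK // gt_eqF.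
have q0 : 0 <= q by rewrite divr_ge0 ?mulr_ge0 // ltW.
have := mulr_ge0 q0 d0; have := mulr_ge0 b0 (ltW D_gt0); nra.
Qed.

(** * Greedy choice of distinct representatives *)

Lemma greedy_representatives (T U : finType) (C : T -> {set U}) (X : {set U}) :
  (forall e, #|X| + #|T| <= #|C e|)%N ->
  exists2 g : T -> U, injective g & forall e, g e \in C e :\: X.
Proof.
move=> C_large.
have C_neq0 e : exists y, y \in C e.
  apply/set0Pn; rewrite -card_gt0.
  apply: leq_trans (C_large e); rewrite addn_gt0; apply/orP; right.
  by apply/card_gt0P; exists e.
(* [g0] only starts the induction; no constant function is at hand, as [U] may be empty when [T]
   is. *)
have [g0 _] := fin_all_exists C_neq0.
suff [g g_inj gC] : exists2 g : T -> U, {in enum T &, injective g} &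
    {in enum T, forall e, g e \in C e :\: X}.
  exists g => [e1 e2|e]; last by apply: gC; rewrite mem_enum.
  by apply: g_inj; rewrite mem_enum.
have: uniq (enum T) by apply: enum_uniq.
elim: (enum T) => [|e s IHs] /=; first by exists g0.
case/andP=> e_notin s_uniq; have [g g_inj gC] := IHs s_uniq.
(* Besides [X], only the values on [s] are forbidden, and [size s < #|T|] because [e :: s] is
   duplicate-free. *)
have [y] : exists y, y \in C e :\: (X :|: [set:: map g s]).
  apply/set0Pn; rewrite -card_gt0 cardsD subn_gt0.
  apply: leq_ltn_trans (subset_leq_card (subsetIr _ _)) _.
  apply: leq_trans (C_large e).
  apply: leq_ltn_trans (leq_card_setU _ _) _; rewrite ltn_add2l.
  have le1 : (#|[set:: map g s]| <= size s)%N.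
    by rewrite cardsE (leq_trans (card_size _)) ?size_map.
  apply: leq_ltn_trans le1 _; have: uniq (e :: s) by rewrite /= e_notin.
  by move/card_uniqP => /= <-; apply: max_card.
rewrite !inE negb_or -andbA => /and3P[yX ys yC].
have ne z : z \in s -> (z == e) = false.
  by move=> zs; apply: contraNF e_notin => /eqP <-.
exists (fun z => if z == e then y else g z) => [z1 z2|z].
  rewrite !inE => /orP[/eqP->|z1s] /orP[/eqP->|z2s] //.
  - by rewrite eqxx ne // => yE; case/mapP: ys; exists z2.
  - by rewrite eqxx ne // => yE; case/mapP: ys; exists z1.
  - by rewrite !ne //; apply: g_inj.
rewrite inE => /orP[/eqP->|zs]; first by rewrite eqxx !inE yX.
by rewrite ne //; apply: gC.
Qed.

(** * Edge sizes, copies and the subdivision *)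

Lemma mem_edge_sizes (V : finType) (E : {set {set V}}) k :
  reflect (exists2 F, F \in E & k = #|F|) (k \in edge_sizes E).
Proof.
by rewrite mem_undup; apply: (iffP fintype.imageP) => -[F FE ->]; exists F.
Qed.

Lemma hcontainsP (V1 V2 : finType) (E1 : {set {set V1}}) (E2 : {set {set V2}}) :
  reflect (exists2 f : V1 -> V2, injective f &
             forall F, F \in E1 -> f @: F \in E2)
          (hcontains E1 E2).
Proof.
apply: (iffP existsP) => [[f /andP[/injectiveP f_inj /forall_inP fE]]|].
  by exists f.
case=> f f_inj fE; exists (finfun f); apply/andP; split.
  by apply/injectiveP => u v; rewrite !ffunE; apply: f_inj.
apply/forall_inP => F /fE.
by rewrite (eq_imset (g := finfun f)) // => u; rewrite ffunE.
Qed.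

Lemma admissibleP (V : finType) (E : {set {set V}}) n (G : {set {set 'I_n}}) :
  reflect ((forall F, F \in G -> #|F| \in edge_sizes E) /\ ~~ hcontains E G)
          (admissible E G).
Proof.
apply: (iffP andP) => -[sz free]; split=> //.
  by move=> F FG; apply: (allP sz); apply/mem_edge_sizes; exists F.
by apply/allP => k /mem_edge_sizes[F FG ->]; apply: sz.
Qed.

Lemma subdivP (V : finType) (E : {set {set V}}) (F : {set subdiv_vertex E}) :
  reflect ((exists F0 : {set V},
              [/\ F0 \in E, #|F0| != 2 & F = (@inl V (two_edges E)) @: F0]) \/
           (exists (e : two_edges E) (x : V),
              x \in val e /\ F = [set inl x; inr e]))
          (F \in subdiv E).
Proof.
rewrite inE; apply: (iffP orP) => -[].
- by case/imsetP => F0; rewrite inE => /andP[? ?] ->; left; exists F0.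
- by case/bigcupP => e _ /imsetP[x xe ->]; right; exists e, x.
- case=> F0 [F0E F02 ->]; left; apply/imsetP; exists F0 => //.
  by rewrite inE F0E.
- case=> e [x [xe ->]]; right; apply/bigcupP; exists e => //.
  by apply/imsetP; exists x.
Qed.

(** Each 2-edge is replaced by halves that again have size 2, so the size 2 survives. *)
Lemma mem_edge_sizes_subdiv (V : finType) (E : {set {set V}}) :
  edge_sizes (subdiv E) =i edge_sizes E.
Proof.
move=> k; apply/mem_edge_sizes/mem_edge_sizes => -[F].
  case/subdivP => [[F0 [F0E _ ->]] ->|[e [x [xe ->]]] ->].
    by exists F0; rewrite // card_imset //; apply: inl_inj.
  have /andP[eE /eqP e2] := valP e.
  by exists (val e); rewrite // cards2 e2.
move=> FE ->; case: (eqVneq #|F| 2) => [F2|F_not2]; last first.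
  exists ((@inl V (two_edges E)) @: F).
    by apply/subdivP; left; exists F.
  by rewrite card_imset //; apply: inl_inj.
have Fe : (F \in E) && (#|F| == 2) by rewrite FE F2.
have [x xF] : exists x, x \in F by apply/set0Pn; rewrite -card_gt0 F2.
exists [set inl x; inr (exist _ F Fe : two_edges E)]; last by rewrite cards2 F2.
by apply/subdivP; right; exists (exist _ F Fe), x.
Qed.

Lemma size_edge_sizes_subdiv (V : finType) (E : {set {set V}}) :
  size (edge_sizes (subdiv E)) = size (edge_sizes E).
Proof.
apply/perm_size/uniq_perm; rewrite ?undup_uniq //.
exact: mem_edge_sizes_subdiv.
Qed.

(** * Pairs with many common neighbours *)

(** Since [[set v; v]] is a singleton, [v != w] keeps 1-edges of [G] from acting as loops. *)
Definition adj (T : finType) (G : {set {set T}}) : rel T :=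
  fun v w => (v != w) && ([set v; w] \in G).

(** The intersection over [F] is the common neighbourhood of a pair, without naming or ordering its
    ends. *)
Definition codegree_graph (T : finType) (G : {set {set T}}) (M : nat) :
    {set {set T}} :=
  [set F : {set T} | if #|F| == 2
     then (M <= #|\bigcap_(v in F) nbhd (adj G) v|)%N else F \in G].

Lemma adj_sym (T : finType) (G : {set {set T}}) : symmetric (adj G).
Proof. by move=> v w; rewrite /adj eq_sym setUC. Qed.

Lemma nbhd_codegree_graph (T : finType) (G : {set {set T}}) M v :
  nbhd (adj (codegree_graph G M)) v = conbhd (adj G) M v.
Proof.
apply/setP => u; rewrite !inE {1}/adj inE cards2 [u == v]eq_sym.
by case: eqVneq => //= vu; rewrite big_setU1 ?big_set1 // inE.
Qed.

(** Handshake lemma: exactly two ordered pairs lie over each 2-edge. *)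
Lemma card_two_edges_double (T : finType) (G : {set {set T}}) :
  (\sum_(F in G | #|F| == 2) 2 = \sum_v #|nbhd (adj G) v|)%N.
Proof.
transitivity (\sum_(p : T * T | adj G p.1 p.2) 1)%N; last first.
  rewrite [RHS](eq_bigr (fun v => \sum_(w | adj G v w) 1)%N).
    by rewrite pair_big_dep.
  by move=> v _; rewrite -sum1_card; apply: eq_bigl => w; rewrite inE.
rewrite (partition_big (fun p : T * T => [set p.1; p.2])
           (fun F => (F \in G) && (#|F| == 2))) /=; last first.
  by move=> [v w] /andP[/= vw ->]; rewrite cards2 vw.
apply: eq_bigr => F /andP[FG /cards2P[x [y [xy FE]]]].
have -> : 2%N = #|[set (x, y); (y, x)]|.
  by rewrite cards2 xpair_eqE negb_and xy.
rewrite -sum1_card; apply: eq_bigl => -[v w]; rewrite !inE !xpair_eqE /adj /=.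
apply/idP/idP => [/orP[] /andP[/eqP-> /eqP->]|].
- by rewrite xy -FE FG eqxx.
- by rewrite eq_sym xy setUC -FE FG eqxx.
case/andP => /andP[vw _] /eqP FE2.
have: v \in F by rewrite -FE2 set21.
have: w \in F by rewrite -FE2 set22.
rewrite FE !inE => /orP[] /eqP wE /orP[] /eqP vE; move: vw.
- by rewrite wE vE eqxx.
- by rewrite wE vE !eqxx orbT.
- by rewrite wE vE !eqxx.
- by rewrite wE vE eqxx.
Qed.

Lemma hcontains_subdiv (V : finType) (E : {set {set V}}) (T : finType)
    (G : {set {set T}}) :
  hcontains E (codegree_graph G #|subdiv_vertex E|) -> hcontains (subdiv E) G.
Proof.
case/hcontainsP => f f_inj fE.
pose C (e : two_edges E) := \bigcap_(v in f @: val e) nbhd (adj G) v.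
have [|g g_inj gC] := @greedy_representatives _ _ C (f @: [set: V]).
  (* The subdivision has [#|V| + #|two_edges E|] vertices: enough common neighbours to avoid the
     image of [f] and to pick one new vertex per 2-edge. *)
  move=> e; have /andP[eE /eqP e2] := valP e.
  have := fE _ eE; rewrite inE card_imset // e2 eqxx; apply: leq_trans.
  by rewrite card_imset // cardsT /subdiv_vertex card_sum.
apply/hcontainsP; exists (fun u => match u with inl v => f v | inr e => g e end).
  have fg v e : f v <> g e.
    by move=> fgE; have := gC e; rewrite inE -fgE imset_f.
  move=> [v1|e1] [v2|e2].
  - by move/f_inj->.
  - by move/fg.
  - by move/esym/fg.
  - by move/g_inj->.
move=> F /subdivP[[F0 [F0E F0_not2 ->]]|[e [x [xe ->]]]].
  have := fE _ F0E; rewrite inE card_imset // (negbTE F0_not2).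
  by rewrite -imset_comp.
rewrite imsetU !imset_set1; have := gC e; rewrite inE => /andP[_ /bigcapP].
by move/(_ (f x) (imset_f _ xe)); rewrite inE => /andP[].
Qed.

Lemma admissible_codegree_graph (V : finType) (E : {set {set V}}) n
    (G : {set {set 'I_n}}) :
  2%N \in edge_sizes E -> admissible (subdiv E) G ->
  admissible E (codegree_graph G #|subdiv_vertex E|).
Proof.
move=> two /admissibleP[szG freeG]; apply/admissibleP; split.
  move=> F; rewrite inE; case: eqP => [-> //|_ FG].
  by rewrite -mem_edge_sizes_subdiv szG.
by apply: contra freeG; apply: hcontains_subdiv.
Qed.

Lemma hdens_split n (G : {set {set 'I_n}}) :
  hdens G = \sum_(F in G | #|F| != 2) ('C(n, #|F|)%:R)^-1 +
            (\sum_v #|nbhd (adj G) v|)%:R / (n * n.-1)%:R.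
Proof.
rewrite /hdens (bigID (fun F : {set 'I_n} => #|F| == 2)) /= addrC; congr (_ + _).
rewrite -card_two_edges_double natr_sum mulr_suml.
apply: eq_bigr => F /andP[_ /eqP ->].
have := bin2 n; rewrite -divn2 => binE.
have -> : (n * n.-1 = 'C(n, 2) * 2)%N.
  by rewrite binE divnK // dvdn2; case: (n) => //= m; rewrite oddM /= andNb.
(* For [n < 2] both sides are 0, by the convention on inverting 0. *)
case: (posnP 'C(n, 2)) => [->|b0]; first by rewrite mul0n invr0 mulr0.
by rewrite natrM; field; rewrite pnatr_eq0 -lt0n b0.
Qed.

Lemma hdens_codegree_graph n (G : {set {set 'I_n}}) M :
  (2 <= n)%N ->
  hdens G <= hdens (codegree_graph G M) + 3 * (M%:R + 2) / Num.sqrt n.+1%:R.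
Proof.
move=> n_ge2; rewrite [hdens G]hdens_split hdens_split.
have -> : \sum_(F in codegree_graph G M | #|F| != 2) ('C(n, #|F|)%:R)^-1 =
          \sum_(F in G | #|F| != 2) ('C(n, #|F|)%:R)^-1 :> Rdefinitions.R.
  by apply: eq_bigl => F; rewrite inE; case: eqP; rewrite ?andbF.
rewrite -addrA lerD2l.
(* This choice balances the errors [D] and [M * n / D], both of order [sqrt n] for fixed [M]. *)
set D : Rdefinitions.R := Num.sqrt n.+1%:R.
have D2 : D * D = n%:R + 1 by rewrite -expr2 sqr_sqrtr // natr1.
have D0 : 0 < D by rewrite sqrtr_gt0 ltr0n.
have := sum_degree_le_conbhd M (@adj_sym _ G) D0.
rewrite card_ord -!natr_sum.
rewrite -(eq_bigr _ (fun v _ => congr1 (fun A : {set 'I_n} => #|A|)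
            (nbhd_codegree_graph G M v))).
set A := (\sum_v _)%:R; set B := (\sum_v _)%:R => AB.
have n2 : 2 <= n%:R :> Rdefinitions.R by rewrite (ler_nat _ 2).
have nnE : (n * n.-1)%:R = n%:R * (n%:R - 1) :> Rdefinitions.R.
  by rewrite natrM -subn1 natrB // (leq_trans _ n_ge2).
have nn0 : 0 < n%:R * (n%:R - 1) :> Rdefinitions.R by apply: mulr_gt0; lra.
rewrite nnE ler_pdivrMr // mulrDl divfK ?gt_eqF //.
apply: le_trans AB _; rewrite lerD2l.
set N : Rdefinitions.R := n%:R in D2 n2 nn0 *.
set m : Rdefinitions.R := M%:R; have m0 : 0 <= m by [].
have -> : 3 * (m + 2) / D * (N * (N - 1)) = N * ((m + 2) * (3 * (N - 1)) / D).
  by field; rewrite gt_eqF.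
apply: ler_wpM2l; first by lra.
rewrite ler_pdivlMr // mulrDl divfK ?gt_eqF //.
(* As [D <= D * D = N + 1], it suffices that [2 (N + 1) + m N <= 3 (m + 2) (N - 1)], which holds
   from [N = 2] on. *)
have D1 : 1 <= D by nra.
by nra.
Qed.

(** * Bounds on [pi_n] and the limit *)

Lemma pi_n_subdiv_le (V : finType) (E : {set {set V}}) n :
  2%N \in edge_sizes E -> (2 <= n)%N ->
  pi_n (subdiv E) n <=
  pi_n E n + 3 * (#|subdiv_vertex E|%:R + 2) / Num.sqrt n.+1%:R.
Proof.
move=> two n_ge2.
have pi0 : 0 <= pi_n E n by apply: bigmax_ge_id.
(* The first goal comes from the starting value 0 of the maximum. *)
apply/bigmax_leP; split.
  by rewrite addr_ge0 // divr_ge0 ?sqrtr_ge0 // mulr_ge0 // addr_ge0.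
move=> G admG.
apply: le_trans (hdens_codegree_graph G #|subdiv_vertex E| n_ge2) _.
by rewrite lerD2r; apply: le_bigmax_cond; apply: admissible_codegree_graph.
Qed.

(** Taking all sets of each size other than 2 leaves no image for a 2-edge, and each such size
    contributes exactly 1; [#|V| <= n] keeps the binomials nonzero. *)
Lemma pi_n_ge (V : finType) (E : {set {set V}}) n :
  2%N \in edge_sizes E -> (#|V| <= n)%N ->
  (size (edge_sizes E))%:R - 1 <= pi_n E n.
Proof.
move=> two V_le.
pose s := rem 2%N (edge_sizes E).
have s_uniq : uniq s by rewrite rem_uniq // undup_uniq.
have sE k : (k \in s) = (k != 2%N) && (k \in edge_sizes E).
  by rewrite mem_rem_uniq ?undup_uniq // inE.
pose G := [set F : {set 'I_n} | #|F| \in s].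
have admG : admissible E G.
  apply/admissibleP; split=> [F|]; first by rewrite inE sE => /andP[].
  apply/negP => /hcontainsP[f f_inj fE].
  case/mem_edge_sizes: two => F FE F2.
  by have := fE _ FE; rewrite inE sE card_imset // -F2 eqxx.
suff <- : hdens G = (size (edge_sizes E))%:R - 1.
  exact: (le_bigmax_cond _ _ admG).
have -> : (size (edge_sizes E))%:R - 1 = \sum_(k <- s) 1 :> Rdefinitions.R.
  rewrite big_const_seq count_predT iter_addr_0 size_rem // -subn1 natrB //.
  by case: (edge_sizes E) two.
(* Each [#|F|] occurs exactly once in [s], so the sum can be regrouped by size. *)
rewrite /hdens (eq_bigr (fun F : {set 'I_n} =>
  \sum_(k <- s | k == #|F|) ('C(n, k)%:R)^-1)); last first.
  move=> F; rewrite inE => Fs; rewrite -big_filter filter_pred1_uniq //.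
  by rewrite big_seq1.
rewrite (exchange_big_dep predT) //=; apply: eq_big_seq => k.
rewrite sE => /andP[k_not2 k_size]; rewrite sumr_const.
have -> : #|[pred F : {set 'I_n} | (F \in G) && (k == #|F|)]| = 'C(n, k).
  have := card_draws 'I_n k; rewrite card_ord => <-; apply: eq_card => F.
  rewrite !inE [k == _]eq_sym.
  by case: eqP => [->|]; rewrite ?andbF // sE k_not2 k_size.
rewrite -[_ *+ _]mulr_natr mulVf // pnatr_eq0 -lt0n bin_gt0.
by case/mem_edge_sizes: k_size => F _ ->; rewrite (leq_trans (max_card _)).
Qed.

Lemma cvg_inv_sqrtS (R : realType) :
  ((fun n : nat => (Num.sqrt n.+1%:R)^-1 : R) @ \oo --> (0 : R))%classic.
Proof.
have -> : (fun n : nat => (Num.sqrt n.+1%:R)^-1 : R) =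
          (fun n => Num.sqrt (harmonic n)).
  by apply: funext => n; rewrite /harmonic sqrtrV.
rewrite -[X in (_ --> X)%classic](@sqrtr0 R).
by apply: continuous_cvg; [exact: sqrt_continuous|exact: cvg_harmonic].
Qed.

Local Close Scope ring_scope.

Theorem mainTheorem13 (V : finType) (E : {set {set V}}) :
  (exists2 F, F \in E & #|F| = 2) ->
  degenerate E -> degenerate (subdiv E).
Proof.
move=> [F FE F2] degE.
have two : 2 \in edge_sizes E by apply/mem_edge_sizes; exists F.
have two' : 2 \in edge_sizes (subdiv E) by rewrite mem_edge_sizes_subdiv.
rewrite /degenerate size_edge_sizes_subdiv.
pose c : Rdefinitions.R := (3 * (#|subdiv_vertex E|%:R + 2))%R.
(* The lower bound is [pi_n_ge] for the subdivision itself, valid once [n] reaches its number of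
   vertices. *)
apply: (@squeeze_cvgr _ _ _ _ (fun=> (size (edge_sizes E))%:R - 1)%R
  (fun n => pi_n E n + c * (Num.sqrt n.+1%:R)^-1)%R).
- near=> n; apply/andP; split.
    rewrite -size_edge_sizes_subdiv; apply: pi_n_ge => //.
    by near: n; apply: nbhs_infty_ge.
  by apply: pi_n_subdiv_le => //; near: n; apply: nbhs_infty_ge.
- exact: cvg_cst.
(* Degeneracy of [E] enters here, as the limit of the upper bound. *)
rewrite -[X in (_ --> X)%classic]addr0 -(mulr0 c).
by apply: cvgD => //; apply: cvgMr; apply: cvg_inv_sqrtS.
Unshelve. all: by end_near.
Qed.
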